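(* Let $n\ge 3$ and $m\ge 2$ be integers, and let $V$ be a vertex operator algebra satisfying conditions (I) and (II) of the context for these $n,m$. Let $(\cdot|\cdot)_H$ be the Hermitian form on $V$ defined in the context. Then the restriction of $(\cdot|\cdot)_H$ to $V_2$ is positive definite if and only if: $m\le 3$ in the case $n=3$; and $m=2$ in the case $n\ge 4$.
   Context: All vertex operator algebras (VOAs) are over $\mathbb C$, with vacuum $\mathbf 1$ and conformal vector $\omega$; for $a\in V$ write $Y(a,z)=\sum_{p\in\mathbb Z}a_pz^{-p-1}$, and $Y(\omega,z)=\sum_{p\in\mathbb Z}L(p)z^{-p-2}$. A VOA $V$ is of OZ type (moonshine type) if $V=\bigoplus_{k\ge 0}V_k$ with $V_0=\mathbb C\mathbf 1$ and $V_1=0$. For an integer $m\ge 1$ put $$c_m=1-\frac{6}{(m+2)(m+3)},\qquad h^{(m)}_{r,s}=\frac{[r(m+3)-s(m+2)]^2-1}{4(m+2)(m+3)},$$ so that $h^{(m)}_{m+1,1}=\frac{m(m+1)}{4}$. $L(c,0)$ denotes the simple Virasoro VOA of central charge $c$. Conditions on $V$ (for given integers $n\ge 3$, $m\ge 1$): (I) $V$ is simple, of OZ type, and generated as a vertex operator algebra by $V_2$. (II) $V_2$ is linearly spanned by Virasoro vectors $\omega^{ij}=\omega^{ji}$, $1\le i<j\le n$, such that the vertex subalgebra generated by each $\omega^{ij}$ (with conformal vector $\omega^{ij}$) is isomorphic to $L(c_m,0)$, and for distinct $i,j,k,l\in\{1,\dots,n\}$ (each relation being required whenever the indices occurring in it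 are distinct): $$\omega^{ij}_1\omega^{jl}=\tfrac12 h^{(m)}_{m+1,1}(\omega^{ij}+\omega^{jl}-\omega^{il}),$$ $$\omega^{ij}_p\omega^{kl}=0\ (p\ge 0),\qquad \omega^{ij}_3\omega^{ij}=\tfrac{c_m}{2}\mathbf 1,\qquad \omega^{ij}_3\omega^{jl}=\tfrac{c_m h^{(m)}_{m+1,1}}{8}\mathbf 1.$$ The Hermitian form: since $V$ is simple of OZ type, there is a unique non-degenerate bilinear form $(\cdot|\cdot)$ on $V$ with $(\mathbf 1|\mathbf 1)=1$ and $(v|Y(u,z)w)=(Y(e^{zL(1)}(-z^{-2})^{L(0)}u,z^{-1})v|w)$ for all $u,v,w\in V$. The map $\sigma(a\,\omega^{i_1j_1}_{m_1}\cdots\omega^{i_sj_s}_{m_s}\mathbf 1)=\bar a\,\omega^{i_1j_1}_{m_1}\cdots\omega^{i_sj_s}_{m_s}\mathbf 1$ ($a\in\mathbb C$) extends to a conjugate-linear involution of $V$, and the associated $\sigma$-invariant Hermitian form $(\cdot|\cdot)_H$ (linear in the first, conjugate-linear in the second argument) is determined by $$(au|bv)_H=a\bar b\,(u|v)$$ for $a,b\in\mathbb C$ and all monomials $u=\omega^{i_1j_1}_{m_1}\cdots\omega^{i_sj_s}_{m_s}\mathbf 1$, $v=\omega^{r_1l_1}_{n_1}\cdots\omega^{r_tl_t}_{n_t}\mathbf 1$ with integer modes $m_k,n_p$. *)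

(* Defs.v *)
From HB Require Import structures.
From mathcomp Require Import all_boot all_order all_algebra.
From mathcomp Require Import all_classical reals.
From mathcomp Require Export complex.
Set Implicit Arguments.
Unset Strict Implicit.
Unset Printing Implicit Defensive.
Import Order.TTheory GRing.Theory Num.Theory.
Local Open Scope classical_set_scope.
Local Open Scope ring_scope.

(* The complex numbers are R[i], for an arbitrary model R of the reals. *)

Definition subspace (K : nzRingType) (V : lmodType K) (W : set V) : Prop :=
  W 0 /\ forall (k : K) (u v : V), W u -> W v -> W (k *: u + v).

Definition lspan (K : nzRingType) (V : lmodType K) (S : set V) : set V :=
  smallest (@subspace K V) S.

Definition finite_dimensional (K : nzRingType) (V : lmodType K) (W : set V)
    : Prop :=
  exists s : seq V, W `<=` lspan [set` s].

(* binomial coefficient with integer upper argument *)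
Definition binz (K : fieldType) (p : int) (i : nat) : K :=
  (\prod_(j < i) (p - j%:Z))%:~R / (i`!)%:R.

(* L is a representation of the Virasoro algebra of central charge c *)
Definition virasoro_relations (K : fieldType) (V : lmodType K) (c : K)
    (L : int -> V -> V) : Prop :=
  forall (p q : int) (v : V),
    L p (L q v) - L q (L p v) =
    (p - q)%:~R *: L (p + q) v
    + (((p ^+ 3 - p)%:~R / 12%:R * c) *: v) *+ (p + q == 0).

(* [mode a p b] is a_p b, where Y(a,z) = \sum_p a_p z^(-p-1); thus
   L(p) = conf_(p+1).  The sums over all i : nat below have finite support
   by [truncation]. *)
Record voa (R : realType) := Voa {
  voa_sort :> lmodType R[i];
  mode : voa_sort -> int -> voa_sort -> voa_sort;
  vac : voa_sort;
  conf : voa_sort;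
  central_charge : R[i];
  mode_linearl : forall (k : R[i]) (a a' : voa_sort) (p : int) (b : voa_sort),
    mode (k *: a + a') p b = k *: mode a p b + mode a' p b;
  mode_linearr : forall (k : R[i]) (a : voa_sort) (p : int) (b b' : voa_sort),
    mode a p (k *: b + b') = k *: mode a p b + mode a p b';
  truncation : forall a b : voa_sort,
    exists N : int, forall p : int, N <= p -> mode a p b = 0;
  vacuum : forall (p : int) (b : voa_sort), mode vac p b = b *+ (p == -1);
  creation : forall a : voa_sort,
    mode a (-1) vac = a /\ forall p : int, 0 <= p -> mode a p vac = 0;
  (* the Jacobi identity in components *)
  borcherds : forall (a b c : voa_sort) (p q r : int),
    \sum_(i \in [set: nat])
       binz _ p i *: mode (mode a (r + i%:Z) b) (p + q - i%:Z) c =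
    \sum_(i \in [set: nat])
       ((-1) ^+ i * binz _ r i) *:
         (mode a (p + r - i%:Z) (mode b (q + i%:Z) c)
          - (-1) ^ r *: mode b (q + r - i%:Z) (mode a (p + i%:Z) c));
  conf_virasoro :
    virasoro_relations central_charge (fun p => mode conf (p + 1));
  (* Y(L(-1)a,z) = d/dz Y(a,z) *)
  translation : forall (a : voa_sort) (p : int) (b : voa_sort),
    mode (mode conf 0 a) p b = - p%:~R *: mode a (p - 1) b;
  (* V_k is the eigenspace of L(0) = conf_1 for the eigenvalue k; eigenspaces
     are independent, so spanning gives the direct sum decomposition *)
  grading : forall v : voa_sort,
    lspan (\bigcup_(k in [set: int]) [set u | mode conf 1 u = k%:~R *: u]) v;
  grading_finite : forall k : int,
    finite_dimensional [set u | mode conf 1 u = k%:~R *: u];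
  grading_bounded : exists N : int, forall k : int, k < N ->
    [set u | mode conf 1 u = k%:~R *: u] = [set 0]
}.

Arguments mode {R V} _ _ _ : rename.
Arguments vac {R}.
Arguments conf {R}.
Arguments central_charge {R}.

Section VOA.
Variable R : realType.
Implicit Type V : voa R.

Definition weight V (k : int) : set V :=
  [set u : V | mode (conf V) 1 u = k%:~R *: u].
Arguments weight : clear implicits.

Definition vertex_subalgebra V (W : set V) : Prop :=
  [/\ subspace W, W (vac V) &
      forall (a b : V) (p : int), W a -> W b -> W (mode a p b)].

Definition generated_subalgebra V (S : set V) : set V :=
  smallest (@vertex_subalgebra V) S.

Definition voa_ideal V (I : set V) : Prop :=
  subspace I /\
  forall (a v : V) (p : int), I v -> I (mode a p v) /\ I (mode v p a).

Definition simple_voa V : Prop :=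
  (exists v : V, v <> 0) /\
  forall I : set V, voa_ideal I -> I = [set 0] \/ I = setT.

Definition OZ_type V : Prop :=
  [/\ forall k : int, k < 0 -> weight V k = [set 0],
      weight V 0 = [set a *: vac V | a in [set: R[i]]] &
      weight V 1 = [set 0]].

(* W is the simple Virasoro VOA L(c,0) *)
Definition simple_virasoro_voa (c : R[i]) (W : voa R) : Prop :=
  [/\ central_charge W = c, simple_voa W &
      generated_subalgebra [set conf W] = setT].

Definition virasoro_vector V (c : R[i]) (e : V) : Prop :=
  virasoro_relations c (fun p => mode e (p + 1)).

(* The vertex subalgebra generated by e, with conformal vector e, is
   isomorphic to W: f is the isomorphism, viewed as a map into V. *)
Definition subalgebra_isomorphic V (e : V) (W : voa R) : Prop :=
  exists f : W -> V,
    [/\ forall (k : R[i]) (u v : W), f (k *: u + v) = k *: f u + f v,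
        injective f,
        range f = generated_subalgebra [set e],
        f (vac W) = vac V /\ f (conf W) = e &
        forall (a b : W) (p : int), f (mode a p b) = mode (f a) p (f b)].

Definition cm (m : nat) : R[i] := 1 - 6%:R / ((m + 2) * (m + 3))%:R.

Definition hrs (m r s : nat) : R[i] :=
  (((r * (m + 3))%:R - (s * (m + 2))%:R) ^+ 2 - 1)
  / (4 * (m + 2) * (m + 3))%:R.

Definition condition_I V : Prop :=
  [/\ simple_voa V, OZ_type V & generated_subalgebra (weight V 2) = setT].

(* The diagonal values of w play no role. *)
Definition condition_II V (n m : nat) (w : 'I_n -> 'I_n -> V) : Prop :=
  let c := cm m in
  let h := hrs m (m + 1) 1 in
  (forall i j : 'I_n, i != j -> w i j = w j i) /\
  weight V 2 = lspan [set e | exists i j : 'I_n, i != j /\ e = w i j] /\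
  (forall i j : 'I_n, i != j ->
     virasoro_vector c (w i j) /\
     exists W : voa R,
       simple_virasoro_voa c W /\ subalgebra_isomorphic (w i j) W) /\
  (forall i j l : 'I_n, uniq [:: i; j; l] ->
     mode (w i j) 1 (w j l) = (1 / 2%:R * h) *: (w i j + w j l - w i l)) /\
  (forall (i j k l : 'I_n) (p : int), uniq [:: i; j; k; l] -> 0 <= p ->
     mode (w i j) p (w k l) = 0) /\
  (forall i j : 'I_n, i != j ->
     mode (w i j) 3 (w i j) = (c / 2%:R) *: vac V) /\
  (forall i j l : 'I_n, uniq [:: i; j; l] ->
     mode (w i j) 3 (w j l) = (c * h / 8%:R) *: vac V).

Definition nondegenerate V (B : V -> V -> R[i]) : Prop :=
  (forall u : V, (forall v : V, B u v = 0) -> u = 0) /\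
  (forall v : V, (forall u : V, B u v = 0) -> v = 0).

(* Coefficient of z^(-q-1) in
     (v | Y(u,z)x) = (Y(e^(zL(1)) (-z^-2)^L(0) u, z^-1) v | x)
   for u of weight k, with L(1) = conf_2; homogeneous u suffice by linearity.
   The sum has finite support because L(1)^i u has weight k - i. *)
Definition invariant_form V (B : V -> V -> R[i]) : Prop :=
  forall (k q : int) (u v x : V), weight V k u ->
    B v (mode u q x) =
    (-1) ^ k * \sum_(i \in [set: nat])
      (i`!)%:R^-1 *
      B (mode (iter i (mode (conf V) 2) u) (2 * k - i%:Z - q - 2) v) x.

Definition normalized_invariant_form V (B : V -> V -> R[i]) : Prop :=
  [/\ forall (k : R[i]) (u u' v : V),
        B (k *: u + u') v = k * B u v + B u' v,
      forall (k : R[i]) (u v v' : V),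
        B u (k *: v + v') = k * B u v + B u v',
      nondegenerate B,
      B (vac V) (vac V) = 1 &
      invariant_form B].

(* w^{i_1 j_1}_{m_1} ... w^{i_s j_s}_{m_s} 1, for the list of the triples
   (i_k, j_k, m_k) *)
Definition monomial V (n : nat) (w : 'I_n -> 'I_n -> V)
    (s : seq ('I_n * 'I_n * int)) : V :=
  foldr (fun t v => mode (w t.1.1 t.1.2) t.2 v) (vac V) s.

Definition offdiag (n : nat) (s : seq ('I_n * 'I_n * int)) : bool :=
  all (fun t => t.1.1 != t.1.2) s.

(* V is spanned by the monomials when it is generated by V_2, so B and the
   last clause determine H. *)
Definition associated_hermitian_form V (n : nat) (w : 'I_n -> 'I_n -> V)
    (B H : V -> V -> R[i]) : Prop :=
  [/\ forall (k : R[i]) (u u' v : V),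
        H (k *: u + u') v = k * H u v + H u' v,
      forall (k : R[i]) (u v v' : V),
        H u (k *: v + v') = k^* * H u v + H u v',
      forall u v : V, H v u = (H u v)^* &
      forall (a b : R[i]) (s t : seq ('I_n * 'I_n * int)),
        offdiag s -> offdiag t ->
        H (a *: monomial w s) (b *: monomial w t) =
        a * b^* * B (monomial w s) (monomial w t)].

Definition positive_definite_on V (H : V -> V -> R[i]) (W : set V) : Prop :=
  forall v : V, W v -> v <> 0 -> 0 < H v v.

End VOA.
Arguments weight {R}.

(* Main.v *)
Require Import Defs.
From mathcomp Require Import all_boot all_order all_algebra.
From mathcomp Require Import all_classical reals.
From mathcomp Require Import zify ring.
Set Implicit Arguments.
Unset Strict Implicit.
Unset Printing Implicit Defensive.
Import Order.TTheory GRing.Theory Num.Theory.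
Local Open Scope ring_scope.

(** Since V_0 is spanned by the vacuum and V_1 = 0, the invariant form on V_2 is
    read off from third products: (v|u) = (u_3 v | 1).  The relations in
    condition (II) then give the Gram matrix of the Virasoro vectors w^{ij}, seen
    as indexed by the edges of the complete graph on n vertices.  With c = c_m and
    h = m(m+1)/4 it is c/2 times
      1 on the diagonal, h/4 for edges with one common end, 0 for disjoint edges,
    that is, c/2 (1 + (h/4) A) for the adjacency matrix A of the line graph of K_n
    ([gram]).  As c > 0, definiteness depends on the least eigenvalue of A, which
    is -1 for n = 3 and -2 for n >= 4: the conditions are h < 4, that is m <= 3,
    and h < 2, that is m = 2.

    The w^{ij} may be linearly dependent, so the argument runs on coefficients.
    An element of V_2 is written as a combination of the w^{ij} with a symmetric
    weighting b of the edges, vanishing on loops.  The number of common ends of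
    two edges contributes to H(v,v) a sum of squares |sum_j b_ij|^2 over the
    vertices, and coincidence of edges a multiple of the sum of the |b_ij|^2
    ([hermitian_edge_sum]).  This gives positivity when h < 2; when n = 3 two
    edges always meet, so the common ends minus the coincidences form a constant
    matrix, also a square, and h < 4 suffices.

    Conversely, the alternating sum around a 4-cycle has H(v,v) = 2c(1 - h/2), and
    the difference of two adjacent edges has H(v,v) = c(1 - h/4).  For the
    excluded m these values are negative, not merely zero, so that the vectors
    are automatically nonzero in V. *)

(** * The parameters c and h *)

Lemma hrs_eq (R : realType) (m : nat) :
  hrs R m (m + 1) 1 = (m * (m + 1))%:R / 4%:R.
Proof.
rewrite /hrs !natrM !natrD mul1r.
have m2 : (m%:R + 2%:R : R[i]) != 0 by rewrite -natrD pnatr_eq0 addn2.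
have m3 : (m%:R + 3%:R : R[i]) != 0 by rewrite -natrD pnatr_eq0 addn3.
by field; rewrite m2 m3.
Qed.

Lemma cm_gt0 (R : realType) (m : nat) : (2 <= m)%N -> 0 < cm R m.
Proof.
move=> m2; rewrite /cm subr_gt0 ltr_pdivrMr ?mul1r ?ltr_nat.
  by nia.
by rewrite ltr0n muln_gt0 !addn_gt0 !orbT.
Qed.

(** * The invariant form in weight two *)

Section WeightTwo.
Variables (R : realType) (V : voa R).

Lemma mode0r (a : V) (p : int) : mode a p 0 = 0.
Proof.
have := mode_linearr 1 a p 0 0.
by rewrite !scale1r addr0 => /eqP; rewrite -subr_eq0 opprD addNKr oppr_eq0 => /eqP.
Qed.

Lemma mode0l (p : int) (b : V) : mode 0 p b = 0.
Proof.
have := mode_linearl 1 (0 : V) 0 p b.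
by rewrite !scale1r addr0 => /eqP; rewrite -subr_eq0 opprD addNKr oppr_eq0 => /eqP.
Qed.

Lemma weightZD (k : int) (a : R[i]) (u v : V) :
  weight V k u -> weight V k v -> weight V k (a *: u + v).
Proof.
rewrite /weight /= mode_linearr => -> ->.
by rewrite scalerDr !scalerA mulrC.
Qed.

(** By [L(0), L(1)] = - L(1), the operator L(1) lowers the weight by one, and
    there is nothing in weight one. *)
Lemma weight2_quasiprimary (u : V) :
  OZ_type V -> weight V 2 u -> mode (conf V) 2 u = 0.
Proof.
move=> [_ _ V1] u2; suff: weight V 1 (mode (conf V) 2 u) by rewrite V1.
have : mode (conf V) 1 (mode (conf V) 2 u) - mode (conf V) 2 (mode (conf V) 1 u)
    = (-1) *: mode (conf V) 2 u + 0 := @conf_virasoro R V 0 1 u.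
rewrite /weight /= in u2 *; rewrite u2 addr0 scaleN1r.
rewrite -[_%:~R *: u in LHS]addr0 mode_linearr mode0r addr0.
move/eqP; rewrite subr_eq -scaleN1r -scalerDl => /eqP ->.
by congr (_ *: _); ring.
Qed.

(** Applying invariance to v and u = u_(-1) 1: the corrections by powers of L(1)
    vanish, and only the mode u_3 survives. *)
Lemma form_weight2 (B : V -> V -> R[i]) (u v : V) :
  OZ_type V -> normalized_invariant_form B -> weight V 2 u ->
  B v u = B (mode u 3 v) (vac V).
Proof.
move=> OZ [linl _ _ _ inv] u2; have L1u := weight2_quasiprimary OZ u2.
have B0 x : B 0 x = 0.
  by have := linl (-1) 0 0 x; rewrite scaler0 addr0 mulN1r addNr.
have iterL1 i : iter i.+1 (mode (conf V) 2) u = 0.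
  by elim: i => [|i IH] //; rewrite iterS IH mode0r.
have [u1 _] := creation u; have := inv 2 (-1) u v (vac V) u2; rewrite u1 => ->.
rewrite (fsbigE [:: 0%N]) //=; last first.
  by move=> [|i] // _ _; rewrite iterL1 mode0l B0 mulr0.
by rewrite big_mkcond big_seq1 in_setT /= fact0 invr1 mul1r
  -[_ ^ 2]/((-1) ^+ 2) sqrrN expr1n mul1r.
Qed.
End WeightTwo.

(** * Edges of the complete graph *)

Definition shared_ends (n : nat) (i j k l : 'I_n) : nat :=
  (i == k) + (i == l) + (j == k) + (j == l).

(** Edges are ordered pairs of distinct vertices up to reversal; for pairs of
    distinct vertices the value is 0 or 1. *)
Definition same_edge (n : nat) (i j k l : 'I_n) : nat :=
  ((i == k) && (j == l)) + ((i == l) && (j == k)).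

Lemma sum_delta (U : nmodType) (n : nat) (i : 'I_n) (f : 'I_n -> U) :
  \sum_k f k *+ (i == k) = f i.
Proof.
rewrite (bigD1 i) //= eqxx mulr1n big1 ?addr0 // => k /negPf.
by rewrite eq_sym => ->.
Qed.

Lemma sum_shared_ends (U : nmodType) (n : nat) (f : 'I_n -> 'I_n -> U)
    (i j : 'I_n) :
  \sum_k \sum_l f k l *+ shared_ends i j k l
  = \sum_l f i l + \sum_k f k i + \sum_l f j l + \sum_k f k j.
Proof.
have row a : \sum_k \sum_l f k l *+ (a == k) = \sum_l f a l.
  under eq_bigr do rewrite sumrMnl.
  exact: (sum_delta a (fun k => \sum_l f k l)).
have col a : \sum_k \sum_l f k l *+ (a == l) = \sum_k f k a.
  by apply: eq_bigr => k _; rewrite sum_delta.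
under eq_bigr do under eq_bigr do rewrite /shared_ends !mulrnDr.
under eq_bigr do rewrite !big_split /=.
by rewrite !big_split /= !row !col.
Qed.

Lemma sum_same_edge (U : nmodType) (n : nat) (f : 'I_n -> 'I_n -> U)
    (i j : 'I_n) :
  \sum_k \sum_l f k l *+ same_edge i j k l = f i j + f j i.
Proof.
under eq_bigr do under eq_bigr do
  rewrite /same_edge mulrnDr -!mulnb [X in _ + _ *+ X]mulnC !mulrnA.
under eq_bigr do rewrite big_split /= !sum_delta.
by rewrite big_split /= !sum_delta.
Qed.

(** Two different edges of a triangle have exactly one common end. *)
Lemma shared_ends3 (i j k l : 'I_3) : i != j -> k != l ->
  shared_ends i j k l = (same_edge i j k l).+1.
Proof.
by case: i j k l => [[|[|[|?]]] ?] [[|[|[|?]]] ?] [[|[|[|?]]] ?] [[|[|[|?]]] ?].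
Qed.

(** * The Hermitian form on V_2 *)

Section Gram.
Variables (R : realType) (n m : nat) (V : voa R) (w : 'I_n -> 'I_n -> V).
Variables B H : V -> V -> R[i].
Hypotheses (hI : condition_I V) (hII : condition_II m w).
Hypotheses (hB : normalized_invariant_form B).
Hypothesis (hH : associated_hermitian_form w B H).

Local Notation c := (cm R m).
Local Notation h := (hrs R m (m + 1) 1).

Lemma weight2_w (i j : 'I_n) : i != j -> weight V 2 (w i j).
Proof.
by move=> ij; have [_ [-> _]] := hII; apply: sub_gen_smallest; exists i, j.
Qed.

(** The two coefficients are chosen so that the right-hand side is c/2 for equal
    edges (two shared ends), c h / 8 for edges with one common end, and 0 for
    disjoint edges.  Writing the three cases in one formula is what makes the
    double sum over edges computable. *)
Lemma gram (i j k l : 'I_n) : i != j -> k != l ->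
  H (w i j) (w k l) = c / 2%:R * (h / 4%:R * (shared_ends i j k l)%:R
                       + (1 - h / 2%:R) * (same_edge i j k l)%:R).
Proof.
move=> ij kl.
have [_ OZ _] := hI; have [wC [_ [_ [_ [w0 [w1 w2]]]]]] := hII.
have [linl _ _ B1 _] := hB.
have B0 x : B 0 x = 0.
  by have := linl (-1) 0 0 x; rewrite scaler0 addr0 mulN1r addNr.
have Bvac a : B (a *: vac V) (vac V) = a.
  by have := linl a (vac V) 0 (vac V); rewrite addr0 B1 B0 mulr1 addr0.
have [_ _ _ HB] := hH.
have -> : H (w i j) (w k l) = B (w i j) (w k l).
  have := HB 1 1 [:: (i, j, -1)] [:: (k, l, -1)].
  rewrite /offdiag /= ij kl !scale1r conjC1 !mul1r.
  by rewrite !(fun x => (creation x).1); apply.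
rewrite (form_weight2 _ OZ hB (weight2_w kl)) /shared_ends /same_edge.
(* In each case below, w^{ij} = w^{ji} is used to bring the common vertex into
   the middle position, as in condition (II). *)
have B3 a b d : uniq [:: a; b; d] ->
    B (mode (w a b) 3 (w b d)) (vac V) = c * h / 8%:R.
  by move=> u; rewrite w2 // Bvac.
have B2 a b : a != b -> B (mode (w a b) 3 (w a b)) (vac V) = c / 2%:R.
  by move=> ab; rewrite w1 // Bvac.
have ijF := negPf ij; have klF := negPf kl.
have [ik|ik] := eqVneq i k.
  rewrite -ik in kl klF *; rewrite (eq_sym j) ijF klF.
  have [<-|jl] := eqVneq j l; first by rewrite B2 //=; field.
  rewrite (wC i l) // B3 /=; first by field.
  by rewrite !inE !negb_or eq_sym kl eq_sym jl ij.
have [il|il] := eqVneq i l.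
  rewrite -il in kl klF *; rewrite (eq_sym j i) ijF.
  have [<-|jk] := eqVneq j k; first by rewrite (wC j i) 1?eq_sym // B2 //=; field.
  rewrite B3 /=; first by field.
  by rewrite !inE !negb_or kl eq_sym jk ij.
have [jk|jk] := eqVneq j k.
  rewrite -jk in kl klF *; rewrite klF.
  rewrite (wC j l) // (wC i j) // B3 /=; first by field.
  by rewrite !inE !negb_or eq_sym kl eq_sym il eq_sym ij.
have [jl|jl] := eqVneq j l.
  rewrite -jl in kl klF *.
  rewrite (wC i j) // B3 /=; first by field.
  by rewrite !inE !negb_or kl eq_sym ik eq_sym ij.
rewrite w0 //= ?B0; first by field.
by rewrite !inE !negb_or kl eq_sym ik eq_sym jk eq_sym il eq_sym jl ij.
Qed.

Lemma hermitian_suml (I : finType) (F : I -> V) (u : V) :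
  H (\sum_i F i) u = \sum_i H (F i) u.
Proof.
have [linl _ _ _] := hH.
apply: (big_morph (fun x => H x u)) => [x y|].
  by have := linl 1 x y u; rewrite scale1r mul1r.
by have := linl (-1) 0 0 u; rewrite scaler0 addr0 mulN1r addNr.
Qed.

Lemma hermitian_sumr (I : finType) (F : I -> V) (u : V) :
  H u (\sum_i F i) = \sum_i H u (F i).
Proof.
have [_ _ HC _] := hH.
by rewrite HC hermitian_suml rmorph_sum /=; apply: eq_bigr => i _; rewrite -HC.
Qed.

Lemma hermitianZl (k : R[i]) (u v : V) : H (k *: u) v = k * H u v.
Proof.
have [linl _ _ _] := hH; have := linl k u 0 v.
by have := linl (-1) 0 0 v; rewrite scaler0 !addr0 mulN1r addNr => ->; rewrite addr0.
Qed.

Lemma hermitianZr (k : R[i]) (u v : V) : H u (k *: v) = k^* * H u v.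
Proof. by have [_ _ HC _] := hH; rewrite HC hermitianZl rmorphM /= -HC. Qed.

Definition edge_sum (b : 'I_n -> 'I_n -> R[i]) : V :=
  \sum_i \sum_j b i j *: w i j.

Definition edge_weighting (b : 'I_n -> 'I_n -> R[i]) : Prop :=
  (forall i, b i i = 0) /\ (forall i j, b i j = b j i).

(** Symmetric weightings absorb the relation w^{ij} = w^{ji}: a single w^{kl}
    gets weight 1/2 on both of its orientations. *)
Lemma weight2_edge_sum (v : V) : weight V 2 v ->
  exists2 b, edge_weighting b & v = edge_sum b.
Proof.
have [wC [-> _]] := hII.
apply: (smallest_sub (X := fun u => exists2 b, edge_weighting b & u = edge_sum b)).
  split.
    exists (fun _ _ => 0) => //.
    by rewrite /edge_sum big1 // => i _; rewrite big1 // => j _; rewrite scale0r.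
  move=> k _ _ [a [a0 aC] ->] [b [b0 bC] ->].
  exists (fun i j => k * a i j + b i j); first split.
  - by move=> i; rewrite a0 b0 mulr0 addr0.
  - by move=> i j; rewrite aC bC.
  rewrite /edge_sum scaler_sumr -big_split; apply: eq_bigr => i _ /=.
  rewrite scaler_sumr -big_split; apply: eq_bigr => j _ /=.
  by rewrite scalerDl scalerA.
move=> _ [k [l [kl ->]]].
exists (fun i j => (same_edge k l i j)%:R / 2%:R); first split.
- move=> i; rewrite /same_edge.
  have [ki|_] := eqVneq k i; last by rewrite mul0r.
  by rewrite -ki eq_sym (negPf kl) mul0r.
- by move=> i j; rewrite /same_edge addnC.
rewrite /edge_sum.
under eq_bigr do under eq_bigr do rewrite mulr_natl -scalerMnl.
rewrite sum_same_edge (wC l k) 1?eq_sym // -scalerDl.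
by rewrite (_ : _ + _ = 1) ?scale1r //; field.
Qed.

(** The matrix of shared ends is E^T E for the vertex-edge incidence matrix E,
    whence the sum of squares over vertices; the factors 4 and 2 count the
    orientations of edges.  The constant x serves the triangle, whose Gram matrix
    is also a combination of the constant matrix and the identity. *)
Lemma hermitian_edge_sum (x y z : R[i]) (b : 'I_n -> 'I_n -> R[i]) :
  (forall i j k l : 'I_n, i != j -> k != l ->
     H (w i j) (w k l) =
       x + y * (shared_ends i j k l)%:R + z * (same_edge i j k l)%:R) ->
  edge_weighting b ->
  H (edge_sum b) (edge_sum b) =
    x * `|\sum_i \sum_j b i j| ^+ 2 + 4%:R * y * (\sum_i `|\sum_j b i j| ^+ 2)
    + 2%:R * z * (\sum_i \sum_j `|b i j| ^+ 2).
Proof.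
move=> HK [b0 bC].
pose s i := \sum_j b i j.
have sE i : \sum_j (b j i) = s i by apply: eq_bigr => j _.
have Hw i j : i != j -> H (w i j) (edge_sum b) =
    x * (\sum_i s i)^* + 2%:R * y * ((s i)^* + (s j)^*) + 2%:R * z * (b i j)^*.
  move=> ij; rewrite /edge_sum hermitian_sumr.
  transitivity (\sum_k \sum_l (x * (b k l)^*
      + y * ((b k l)^* *+ shared_ends i j k l)
      + z * ((b k l)^* *+ same_edge i j k l))).
    apply: eq_bigr => k _; rewrite hermitian_sumr; apply: eq_bigr => l _.
    rewrite hermitianZr; have [<-|kl] := eqVneq k l.
      by rewrite b0 conjC0 !mul0rn; ring.
    by rewrite HK // -2!mulr_natr; ring.
  under eq_bigr do rewrite !big_split /= -!mulr_sumr.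
  rewrite !big_split /= -!mulr_sumr sum_shared_ends sum_same_edge (bC j i).
  rewrite -!rmorph_sum /= !sE.
  under eq_bigr do rewrite -rmorph_sum.
  by rewrite -rmorph_sum /= -/(s i) -/(s j); ring.
transitivity (\sum_i \sum_j (x * (\sum_i s i)^* * b i j
      + 2%:R * y * (b i j * (s i)^* + b i j * (s j)^*)
      + 2%:R * z * `|b i j| ^+ 2)).
  rewrite {1}/edge_sum hermitian_suml; apply: eq_bigr => i _.
  rewrite hermitian_suml; apply: eq_bigr => j _; rewrite hermitianZl.
  have [<-|ij] := eqVneq i j; first by rewrite b0 normr0; ring.
  by rewrite Hw // normCK; ring.
under eq_bigr do rewrite !big_split /= -!mulr_sumr big_split /=.
rewrite !big_split /= -!mulr_sumr big_split /=.
rewrite [X in _ * (_ + X)]exchange_big /=.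
have -> : \sum_j \sum_i b i j * (s j)^* = \sum_i `|s i| ^+ 2.
  by apply: eq_bigr => i _; rewrite -mulr_suml sE normCK.
have -> : \sum_i \sum_j b i j * (s i)^* = \sum_i `|s i| ^+ 2.
  by apply: eq_bigr => i _; rewrite -mulr_suml normCK.
by rewrite normCK /s; ring.
Qed.

Lemma positive_definite_weight2 (x y z : R[i]) :
  (forall i j k l : 'I_n, i != j -> k != l ->
     H (w i j) (w k l) =
       x + y * (shared_ends i j k l)%:R + z * (same_edge i j k l)%:R) ->
  0 <= x -> 0 <= y -> 0 < z -> positive_definite_on H (weight V 2).
Proof.
move=> HK x0 y0 z0 v /weight2_edge_sum[b bw ->] v0.
rewrite (hermitian_edge_sum HK bw).
have sq_ge0 (I : finType) (f : I -> R[i]) : 0 <= \sum_i `|f i| ^+ 2.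
  by apply: sumr_ge0 => i _; apply: exprn_ge0.
apply: ltr_wpDl; first by rewrite addr_ge0 // !mulr_ge0 // ?ler0n // exprn_ge0.
apply: mulr_gt0; first by rewrite mulr_gt0 // ltr0n.
rewrite lt0r sumr_ge0 ?andbT; last by move=> i _; exact: sq_ge0.
apply/eqP => b0; apply: v0.
rewrite /edge_sum big1 // => i _; rewrite big1 // => j _.
have /eqP : \sum_j `|b i j| ^+ 2 = 0.
  by move/eqP: b0; rewrite psumr_eq0 // => /allP /(_ i) /(_ (mem_index_enum _)) /eqP.
rewrite psumr_eq0 => [/allP /(_ j) /(_ (mem_index_enum _))|? _]; last exact: exprn_ge0.
by rewrite /= expf_eq0 /= normr_eq0 => /eqP ->; rewrite scale0r.
Qed.

(** In a triangle the difference of two edges is an eigenvector of the adjacency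
    of edges for the eigenvalue -1, which gives the factor 1 - h/4. *)
Lemma hermitian_path (i j k : 'I_n) : uniq [:: i; j; k] ->
  let v := -1 *: w j k + w i j in H v v = c * (1 - h / 4%:R).
Proof.
rewrite /= !inE !negb_or !andbT => /andP[/andP[ij ik] jk].
have [linl linr _ _] := hH.
have [ji ki kj] : [/\ j != i, k != i & k != j] by rewrite !(eq_sym k) eq_sym.
rewrite !linl !linr !gram // /shared_ends /same_edge ?conjCN1 ?conjC1.
rewrite !eqxx !(negPf ij, negPf ik, negPf jk, negPf kj, negPf ki, negPf ji) /=.
by field.
Qed.

(** The vertex sums of an alternating weighting of a 4-cycle vanish, so it is an
    eigenvector of the adjacency of edges for the eigenvalue -2, which gives the
    factor 1 - h/2. *)
Lemma hermitian_4cycle (i j k l : 'I_n) : uniq [:: i; j; k; l] ->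
  let v := -1 *: w j k + (-1 *: w l i + (1 *: w i j + w k l)) in
  H v v = 2%:R * c * (1 - h / 2%:R).
Proof.
rewrite /= !inE !negb_or !andbT => /and3P[/and3P[ij ik il] /andP[jk jl] kl].
have [linl linr _ _] := hH.
have [ji ki kj] : [/\ j != i, k != i & k != j] by rewrite !(eq_sym k) eq_sym.
have [li lj lk] : [/\ l != i, l != j & l != k] by rewrite !(eq_sym l).
rewrite !linl !linr !gram // /shared_ends /same_edge ?conjCN1 ?conjC1.
rewrite !eqxx !(negPf ij, negPf ik, negPf jk, negPf kj, negPf ki, negPf ji).
rewrite !(negPf il, negPf jl, negPf kl, negPf li, negPf lj, negPf lk) /=.
by field.
Qed.

End Gram.

Theorem proposition4p1 (R : realType) (n m : nat)
    (hn : (3 <= n)%N) (hm : (2 <= m)%N)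
    (V : voa R) (w : 'I_n -> 'I_n -> V)
    (hI : condition_I V) (hII : condition_II m w)
    (B : V -> V -> R[i]) (hB : normalized_invariant_form B)
    (H : V -> V -> R[i]) (hH : associated_hermitian_form w B H) :
  positive_definite_on H (weight V 2) <->
  ((n = 3%N -> (m <= 3)%N) /\ ((4 <= n)%N -> m = 2%N)).
Proof.
have c0 := cm_gt0 R hm.
have c20 : 0 < cm R m / 2%:R by rewrite divr_gt0 // ltr0n.
have hE := hrs_eq R m.
set h := hrs R m (m + 1) 1 in hE.
have h0 : 0 <= h by rewrite hE divr_ge0 ?ler0n.
have G := gram hI hII hB hH.
rewrite -/h in G.
(* A negative value already forces the vector to be nonzero. *)
have neg v : positive_definite_on H (weight V 2) -> weight V 2 v -> ~ H v v < 0.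
  move=> pd v2 Hv.
  have [v0|/eqP v0] := eqVneq v 0; last by have := lt_trans Hv (pd v v2 v0); rewrite ltxx.
  have [linl _ _ _] := hH; move: Hv; rewrite v0.
  by have := linl (-1) 0 0 0; rewrite scaler0 addr0 mulN1r addNr => ->; rewrite ltxx.
have W2 := weight2_w hII.
split=> [pd|[n3 n4]].
  pose i0 := Ordinal (leq_trans (isT : (0 < 3)%N) hn).
  pose i1 := Ordinal (leq_trans (isT : (1 < 3)%N) hn).
  pose i2 := Ordinal (leq_trans (isT : (2 < 3)%N) hn).
  split=> [n3|n4].
    (* m >= 4 gives h >= 5 > 4. *)
    rewrite leqNgt; apply/negP => m4.
    apply: (neg (-1 *: w i1 i2 + w i0 i1)) => //.
      by apply: weightZD; apply: W2.
    rewrite (hermitian_path hI hII hB hH) // -/h pmulr_rlt0 // subr_lt0.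
    by rewrite ltr_pdivlMr ?ltr0n // mul1r hE ltr_pdivlMr ?ltr0n // -natrM ltr_nat; nia.
  (* m >= 3 gives h >= 3 > 2. *)
  pose i3 := Ordinal n4.
  apply/eqP; rewrite eqn_leq hm andbT leqNgt; apply/negP => m3.
  apply: (neg (-1 *: w i1 i2 + (-1 *: w i3 i0 + (1 *: w i0 i1 + w i2 i3)))) => //.
    by do 3! [apply: weightZD; first exact: W2]; apply: W2.
  rewrite (hermitian_4cycle hI hII hB hH) // -/h pmulr_rlt0 ?mulr_gt0 ?ltr0n //.
  by rewrite subr_lt0 ltr_pdivlMr ?ltr0n // mul1r hE ltr_pdivlMr ?ltr0n // -natrM ltr_nat; nia.
have Gsmall : h < 2%:R -> positive_definite_on H (weight V 2).
  move=> h2; apply: (positive_definite_weight2 hII hH (x := 0)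
    (y := cm R m / 2%:R * (h / 4%:R)) (z := cm R m / 2%:R * (1 - h / 2%:R))) => //.
  - by move=> i j k l ij kl; rewrite G //; ring.
  - exact: mulr_ge0 (ltW c20) (divr_ge0 h0 (ler0n _ _)).
  - apply: mulr_gt0 => //; rewrite subr_gt0.
    by rewrite ltr_pdivrMr ?ltr0n // mul1r.
case: (ltngtP n 3) hn => // [n4' _|n3' _].
  apply: Gsmall; rewrite hE n4 //.
  by rewrite ltr_pdivrMr ?ltr0n // -natrM ltr_nat.
have m3 := n3 n3'; subst n.
move: m3; rewrite leq_eqVlt => /orP[/eqP m3|m2]; last first.
  apply: Gsmall; rewrite hE.
  by rewrite ltr_pdivrMr ?ltr0n // -natrM ltr_nat; nia.
(* For the triangle with m = 3 one has h = 3, beyond the bound h < 2: rewrite the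
   shared ends as 1 plus the coincidences, which leaves the factor 1 - h/4. *)
apply: (positive_definite_weight2 hII hH (x := cm R m / 2%:R * (h / 4%:R))
    (y := 0) (z := cm R m / 2%:R * (1 - h / 4%:R))) => //.
- by move=> i j k l ij kl; rewrite G // shared_ends3 // -natr1; field.
- exact: mulr_ge0 (ltW c20) (divr_ge0 h0 (ler0n _ _)).
- apply: mulr_gt0 => //; rewrite subr_gt0 ltr_pdivrMr ?ltr0n // mul1r hE m3.
  by rewrite ltr_pdivrMr ?ltr0n // -natrM ltr_nat.
Qed.
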